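(* For every $r>0$, $$\frac{r^2}{\sqrt{r^4+4r^2+30+6\sqrt{21}}}<f_2(r)<\frac{r^2}{\sqrt{r^4+4r^2+24}}.$$ Moreover, for every $r>0$ and every real $C$ with $0<C<792$, $$g_{4000}(r)<f_3(r)<g_C(r),$$ where for $C>0$ $$g_C(r)=\frac{r^3}{\sqrt{r^6+9r^4+99r^2+C}}.$$
   Context: For each integer $n\ge1$, $f_n$ denotes the unique nonnegative, strictly increasing solution on $(0,\infty)$ of $$f_n''+\frac1r f_n'-\frac{n^2}{r^2}f_n+(1-f_n^2)f_n=0,\qquad f_n(0)=0,\quad f_n(+\infty)=1$$ (its existence and uniqueness are classical). It is known that $f_n(r)=\kappa_nr^n(1+O(r^2))$ as $r\to0$ for some $\kappa_n>0$, and that $$f_n(r)=1-\frac{n^2}{2r^2}-\frac{n^2(n^2+8)}{8r^4}-\frac{n^2(n^4+32n^2+128)}{16r^6}+O(r^{-8})\qquad\text{as }r\to\infty.$$ *)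

(* Defs.v *)
From Stdlib Require Import Reals.
From Coquelicot Require Import Coquelicot.
Open Scope R_scope.

(* The profile lives on (0, +oo) only: the values of [f] on (-oo, 0] are
   irrelevant, and the condition f(0) = 0 is the limit at 0+.  [Derive] is
   total, so twice differentiability is required separately. *)
Record vortex_profile (n : nat) (f : R -> R) : Prop := {
  vp_ex_derive : forall r, 0 < r -> ex_derive f r;
  vp_ex_derive2 : forall r, 0 < r -> ex_derive (Derive f) r;
  vp_ode : forall r, 0 < r ->
    Derive (Derive f) r + 1 / r * Derive f r - INR n ^ 2 / r ^ 2 * f r
      + (1 - f r ^ 2) * f r = 0;
  vp_at_zero : filterlim f (at_right 0) (locally 0);
  vp_at_infty : is_lim f p_infty 1;
  vp_nonneg : forall r, 0 < r -> 0 <= f r;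
  vp_increasing : forall r s, 0 < r -> r < s -> f r < f s
}.

Definition g (C r : R) : R :=
  r ^ 3 / sqrt (r ^ 6 + 9 * r ^ 4 + 99 * r ^ 2 + C).

(* Main.v *)
Require Import Defs.
From Stdlib Require Import Reals Lra Lia Psatz.
From Coquelicot Require Import Coquelicot.
Open Scope R_scope.

(** The bounds are a comparison principle applied to explicit functions
    w = r^n / sqrt P, with P an even monic polynomial of degree 2 n.  Write
    L u = u'' + u'/r - (n^2/r^2) u + (1 - u^2) u.

    Comparison.  Suppose L u >= 0 >= L v with u and v positive.  The weighted
    Wronskian h = r (u v' - v u') satisfies
      h' = r (u L v - v L u + u v (v^2 - u^2)),
    so h decreases wherever u > v, while (u/v)' = - h / (r v^2).  Hence u/v
    cannot have an interior maximum above 1, and if u/v > 1 at some r0 it stays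
    above 1 on the whole of one side of r0.  To the right this would force h below
    a negative constant, and u/v would grow like a logarithm, although it is
    bounded.  To the left it would force h above a positive constant, although
    h -> 0 at 0.  So u <= v ([sub_le_super]).  If u and v touch, then z = v - u
    solves a linear differential inequality with zero Cauchy data, hence vanishes
    to the right of the contact point, where L u = L v ([sub_lt_super]).  For f_n
    itself the bounds on f_n and f_n' that enter here follow from the equation,
    monotonicity and the two limits ([vortex_profile_shape]).

    Computation.  With x = r^2, the sign of L w is that of a polynomial N(x)
    ([ansatz_residual], [quartic_excess], [sextic_excess]):
      for P = x^2 + 4 x + c,
        N = (c - 24) (x^2 + c) - 8 (c + 6) x;
      for P = x^3 + 9 x^2 + 99 x + C,
        N = (C - 1440) x^3 - (18 C + 4455) x^2 + (18 C - 49005) x + C (C - 792).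
    In the first, c = 24 gives N < 0, and c = 30 + 6 sqrt 21 is the value at which
    N acquires a double root and becomes a nonnegative multiple of a square.  In
    the second, every coefficient is negative when 0 < C < 792, and N > 0 for
    C = 4000. *)

(** * One-variable calculus *)

Lemma mean_value (F dF : R -> R) (a b : R) :
  a < b -> (forall x, a <= x <= b -> is_derive F x (dF x)) ->
  exists x, a < x < b /\ F b - F a = dF x * (b - a).
Proof.
  intros Hab HF.
  destruct (MVT_cor2 F dF a b Hab) as [x [E Hx]].
  - intros x Hx. apply is_derive_Reals, HF, Hx.
  - now exists x.
Qed.

Lemma is_derive_neg_right (F : R -> R) (x d : R) :
  is_derive F x d -> d < 0 ->
  exists e, 0 < e /\ forall t, 0 < t < e -> F (x + t) < F x.
Proof.
  intros HF Hd. apply is_derive_Reals in HF.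
  destruct (HF (- d)) as [[e He] H]; [lra|]. simpl in H.
  exists e. split; [exact He|]. intros t Ht.
  assert (Ht0 : t <> 0) by lra.
  specialize (H t Ht0). rewrite Rabs_right in H by lra.
  specialize (H (proj2 Ht)). apply Rabs_def2 in H.
  assert (Hq : (F (x + t) - F x) / t < 0) by lra.
  assert (E : F (x + t) - F x = (F (x + t) - F x) / t * t) by (field; lra).
  nra.
Qed.

Lemma is_derive_neg_left (F : R -> R) (x d : R) :
  is_derive F x d -> d < 0 ->
  exists e, 0 < e /\ forall t, 0 < t < e -> F x < F (x - t).
Proof.
  intros HF Hd. apply is_derive_Reals in HF.
  destruct (HF (- d)) as [[e He] H]; [lra|]. simpl in H.
  exists e. split; [exact He|]. intros t Ht.
  assert (Ht0 : - t <> 0) by lra.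
  specialize (H (- t) Ht0). rewrite Rabs_left in H by lra.
  assert (Ht' : - - t < e) by lra.
  specialize (H Ht'). apply Rabs_def2 in H.
  replace (x + - t) with (x - t) in H by ring.
  assert (Hq : (F (x - t) - F x) / - t < 0) by lra.
  assert (E : F (x - t) - F x = (F (x - t) - F x) / - t * - t) by (field; lra).
  nra.
Qed.

Lemma small_step (e l : R) : 0 < e -> 0 < l -> exists t, 0 < t < e /\ t <= l.
Proof.
  intros He Hl. exists (Rmin (e / 2) l).
  pose proof (Rmin_l (e / 2) l). pose proof (Rmin_r (e / 2) l).
  assert (0 < Rmin (e / 2) l) by (apply Rmin_pos; lra). lra.
Qed.

(** Where the quotient [q] exceeds 1 its weighted derivative [- h] increases, so
    [q] behaves like a convex function there: once above 1 and not decreasing, it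
    cannot come back.  Indeed [h <= 0] at a maximum of [q] on [[a, b]], and [h' < 0]
    makes [q] increase just to the right of it. *)
Lemma excursion_right (q p h dh : R -> R) (a b : R) :
  a <= b ->
  (forall x, a <= x <= b -> is_derive q x (- (p x * h x))) ->
  (forall x, a <= x <= b -> 0 < p x) ->
  (forall x, a <= x <= b -> is_derive h x (dh x)) ->
  (forall x, a <= x <= b -> 1 < q x -> dh x < 0) ->
  1 < q a -> h a <= 0 -> 1 < q b.
Proof.
  intros Hab Hq Hp Hh Hdh Hqa Hha.
  destruct (Rlt_le_dec 1 (q b)) as [H | Hqb]; [exact H | exfalso].
  destruct (continuity_ab_maj q a b Hab) as [m [Hmax Hm]].
  { intros x Hx. apply continuity_pt_filterlim, (ex_derive_continuous q).
    eexists. apply Hq, Hx. }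
  assert (Hqm : 1 < q m) by (pose proof (Hmax a ltac:(lra)); lra).
  assert (Hmb : m < b).
  { destruct (proj2 Hm) as [H | H]; [exact H |]. subst m. lra. }
  assert (Hhm : h m <= 0).
  { destruct (Rle_lt_dec (h m) 0) as [H | H]; [exact H | exfalso].
    destruct (proj1 Hm) as [Ham | Ham]; [| subst m; lra].
    destruct (is_derive_neg_left q m (- (p m * h m))) as [e [He Hl]].
    - apply Hq, Hm.
    - pose proof (Hp m Hm). nra.
    - destruct (small_step e (m - a)) as [t [Ht Hta]]; try lra.
      pose proof (Hl t Ht). pose proof (Hmax (m - t) ltac:(lra)). lra. }
  destruct (is_derive_neg_right h m (dh m)) as [e [He Hr]].
  { apply Hh, Hm. }
  { now apply Hdh. }
  destruct (small_step e (b - m)) as [t [Ht Htb]]; try lra.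
  destruct (mean_value q (fun x => - (p x * h x)) m (m + t)) as [y [Hy E]];
    [lra | intros x Hx; apply Hq; lra |].
  pose proof (Hr (y - m) ltac:(lra)) as Hhy.
  replace (m + (y - m)) with y in Hhy by ring.
  pose proof (Hp y ltac:(lra)).
  pose proof (Hmax (m + t) ltac:(lra)).
  assert (0 < - (p y * h y)) by nra.
  nra.
Qed.

(** The mirror image of [excursion_right] under [x |-> - x], which changes the sign
    of [h] as well. *)
Lemma excursion_left (q p h dh : R -> R) (a b : R) :
  a <= b ->
  (forall x, a <= x <= b -> is_derive q x (- (p x * h x))) ->
  (forall x, a <= x <= b -> 0 < p x) ->
  (forall x, a <= x <= b -> is_derive h x (dh x)) ->
  (forall x, a <= x <= b -> 1 < q x -> dh x < 0) ->
  1 < q b -> 0 <= h b -> 1 < q a.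
Proof.
  intros Hab Hq Hp Hh Hdh Hqb Hhb.
  pose proof (excursion_right (fun x => q (- x)) (fun x => p (- x))
    (fun x => - h (- x)) (fun x => dh (- x)) (- b) (- a)) as H.
  cbv beta in H. rewrite !Ropp_involutive in H. apply H; try lra.
  - intros x Hx.
    replace (- (p (- x) * - h (- x))) with (- 1 * - (p (- x) * h (- x))) by ring.
    apply (is_derive_comp q Ropp x); [apply Hq; lra |].
    auto_derive; [exact I | ring].
  - intros x Hx. apply Hp. lra.
  - intros x Hx.
    replace (dh (- x)) with (opp (- 1 * dh (- x)))
      by (unfold opp; simpl; ring).
    apply (is_derive_opp (fun x => h (- x))).
    apply (is_derive_comp h Ropp x); [apply Hh; lra |].
    auto_derive; [exact I | ring].
  - intros x Hx. apply Hdh. lra.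
Qed.

Lemma derive_at_zero_minimum (z : R -> R) (x d : R) :
  0 < x -> (forall r, 0 < r -> 0 <= z r) -> z x = 0 -> is_derive z x d -> d = 0.
Proof.
  intros Hx Hz Hzx Dz.
  destruct (Rtotal_order d 0) as [Hd | [Hd | Hd]]; [exfalso | exact Hd | exfalso].
  - destruct (is_derive_neg_right z x d Dz Hd) as [e [He H]].
    pose proof (H (e / 2) ltac:(lra)). pose proof (Hz (x + e / 2) ltac:(lra)). lra.
  - destruct (is_derive_neg_left (fun r => - z r) x (- d)) as [e [He H]];
      [now apply (is_derive_opp z) | lra |].
    destruct (small_step e (x / 2)) as [t [Ht Htx]]; try lra.
    pose proof (H t Ht). pose proof (Hz (x - t) ltac:(lra)). lra.
Qed.

(** In the variable [ln r] the inequality reads z'' <= l^2 z, and the operator factors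
    as (d - l) (d + l).  Integrating the two first-order factors in turn, from zero
    data, gives first [r z' + l z <= 0] and then [z <= 0]. *)
Lemma zero_cauchy_data_nonpos (z dz d2z : R -> R) (l a b : R) :
  0 < a -> a <= b -> 0 <= l ->
  (forall r, a <= r <= b -> is_derive z r (dz r)) ->
  (forall r, a <= r <= b -> is_derive dz r (d2z r)) ->
  (forall r, a <= r <= b -> r * (r * d2z r + dz r) <= l ^ 2 * z r) ->
  z a = 0 -> dz a = 0 -> z b <= 0.
Proof.
  intros Ha Hab Hl Dz D2z Hineq Hza Hdza.
  set (E := fun r => (r * dz r + l * z r) * exp (- l * ln r)).
  set (dE := fun r => (r * d2z r + dz r + l * dz r
                       - l * (r * dz r + l * z r) / r) * exp (- l * ln r)).
  assert (HdE : forall r, a <= r <= b -> is_derive E r (dE r)).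
  { intros r Hr. unfold E, dE. auto_derive.
    - repeat split; try lra; eexists; [apply D2z | apply Dz]; exact Hr.
    - replace (Derive (fun x => z x) r) with (dz r)
        by (symmetry; apply is_derive_unique, Dz, Hr).
      replace (Derive (fun x => dz x) r) with (d2z r)
        by (symmetry; apply is_derive_unique, D2z, Hr).
      field. lra. }
  assert (HE : forall r, a <= r <= b -> r * dz r + l * z r <= 0).
  { intros r Hr. destruct (proj1 Hr) as [Har | <-]; [| rewrite Hza, Hdza; lra].
    destruct (mean_value E dE a r Har) as [y [Hy Eq]];
      [intros x Hx; apply HdE; lra |].
    assert (HdEy : dE y <= 0).
    { unfold dE. pose proof (exp_pos (- l * ln y)).
      assert (Hy0 : 0 < y) by lra.
      pose proof (Hineq y ltac:(lra)).
      assert (Hfac : y * d2z y + dz y + l * dz y - l * (y * dz y + l * z y) / y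
        = (y * (y * d2z y + dz y) - l ^ 2 * z y) * / y) by (field; lra).
      assert (0 < / y) by (apply Rinv_0_lt_compat; lra).
      assert ((y * (y * d2z y + dz y) - l ^ 2 * z y) * / y <= 0) by nra.
      nra. }
    assert (HEr : E r <= 0).
    { assert (E a = 0) by (unfold E; rewrite Hza, Hdza; ring). nra. }
    unfold E in HEr. pose proof (exp_pos (- l * ln r)). nra. }
  destruct Hab as [Hab | <-]; [| lra].
  destruct (mean_value (fun r => z r * exp (l * ln r))
    (fun r => (r * dz r + l * z r) / r * exp (l * ln r)) a b Hab) as [y [Hy Eq]].
  { intros r Hr. auto_derive.
    - repeat split; try lra; eexists; apply Dz; exact Hr.
    - replace (Derive (fun x => z x) r) with (dz r)
        by (symmetry; apply is_derive_unique, Dz, Hr).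
      field. lra. }
  cbv beta in Eq. rewrite Hza in Eq.
  pose proof (exp_pos (l * ln y)). pose proof (exp_pos (l * ln b)).
  pose proof (HE y ltac:(lra)).
  assert (0 < / y) by (apply Rinv_0_lt_compat; lra).
  assert ((y * dz y + l * z y) / y <= 0) by (unfold Rdiv; nra).
  assert ((y * dz y + l * z y) / y * exp (l * ln y) <= 0) by nra.
  nra.
Qed.

(** * The comparison principle *)

Definition vortex_residual (n : nat) (u du d2u : R -> R) (r : R) : R :=
  d2u r + 1 / r * du r - INR n ^ 2 / r ^ 2 * u r + (1 - u r ^ 2) * u r.

(** What the comparison principle needs of a function besides the sign of its
    residual: [ps_slope] serves to make the Wronskian vanish at 0, and [ps_floor]
    to keep quotients bounded at infinity. *)
Record profile_shape (u du d2u : R -> R) : Prop := {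
  ps_derive : forall r, 0 < r -> is_derive u r (du r);
  ps_derive2 : forall r, 0 < r -> is_derive du r (d2u r);
  ps_pos : forall r, 0 < r -> 0 < u r;
  ps_le_1 : forall r, 0 < r -> u r <= 1;
  ps_at_zero : filterlim u (at_right 0) (locally 0);
  ps_slope : exists M, forall r, 0 < r <= 1 -> Rabs (r * du r) <= M;
  ps_floor : exists m, 0 < m /\ forall r, 1 <= r -> m <= u r
}.

(** The factor [r] comes from the self-adjoint form (r u')' of r u'' + u': it
    removes the first-order terms from the derivative. *)
Definition wronskian (u du v dv : R -> R) (r : R) : R :=
  r * (u r * dv r - v r * du r).

Section Comparison.

Variables (n : nat) (u du d2u v dv d2v : R -> R).
Hypothesis Hu : profile_shape u du d2u.
Hypothesis Hv : profile_shape v dv d2v.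

Let Lu := vortex_residual n u du d2u.
Let Lv := vortex_residual n v dv d2v.
Let h := wronskian u du v dv.
Let dh r := r * (u r * Lv r - v r * Lu r + u r * v r * (v r ^ 2 - u r ^ 2)).

Lemma is_derive_wronskian (r : R) : 0 < r -> is_derive h r (dh r).
Proof.
  intros Hr.
  pose proof (ps_derive _ _ _ Hu r Hr) as Du.
  pose proof (ps_derive _ _ _ Hv r Hr) as Dv.
  pose proof (ps_derive2 _ _ _ Hu r Hr) as D2u.
  pose proof (ps_derive2 _ _ _ Hv r Hr) as D2v.
  unfold h, wronskian. auto_derive.
  - repeat split; eexists; eassumption.
  - replace (Derive (fun x => u x) r) with (du r) by now symmetry; apply is_derive_unique.
    replace (Derive (fun x => v x) r) with (dv r) by now symmetry; apply is_derive_unique.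
    replace (Derive (fun x => du x) r) with (d2u r) by now symmetry; apply is_derive_unique.
    replace (Derive (fun x => dv x) r) with (d2v r) by now symmetry; apply is_derive_unique.
    unfold dh, Lu, Lv, vortex_residual. field. lra.
Qed.

Lemma is_derive_ratio (r : R) :
  0 < r -> is_derive (fun x => u x / v x) r (- (/ (r * v r ^ 2) * h r)).
Proof.
  intros Hr.
  pose proof (ps_derive _ _ _ Hu r Hr) as Du.
  pose proof (ps_derive _ _ _ Hv r Hr) as Dv.
  pose proof (ps_pos _ _ _ Hv r Hr) as Pv.
  auto_derive.
  - repeat split; try (eexists; eassumption). lra.
  - replace (Derive (fun x => u x) r) with (du r) by now symmetry; apply is_derive_unique.
    replace (Derive (fun x => v x) r) with (dv r) by now symmetry; apply is_derive_unique.
    unfold h, wronskian. field. lra.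
Qed.

Lemma wronskian_small (d a : R) :
  0 < d -> 0 < a -> exists r, 0 < r < a /\ Rabs (h r) < d.
Proof.
  intros Hd Ha.
  destruct (ps_slope _ _ _ Hu) as [M HM].
  destruct (ps_slope _ _ _ Hv) as [N HN].
  set (K := Rmax M N).
  assert (HK : 0 <= K).
  { apply Rle_trans with M; [| apply Rmax_l].
    apply Rle_trans with (2 := HM 1 ltac:(lra)). apply Rabs_pos. }
  assert (He : 0 < d / (2 * K + 1)) by (apply Rdiv_lt_0_compat; lra).
  set (e := mkposreal _ He).
  pose proof (ps_at_zero _ _ _ Hu _ (locally_ball 0 e)) as Fu.
  pose proof (ps_at_zero _ _ _ Hv _ (locally_ball 0 e)) as Fv.
  unfold filtermap in Fu, Fv.
  assert (Fr : at_right 0 (fun r => 0 < r < Rmin a 1)).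
  { assert (Hm : 0 < Rmin a 1) by (apply Rmin_pos; lra).
    exists (mkposreal _ Hm). intros y Hy Hy0. split; [exact Hy0 |].
    unfold ball in Hy; simpl in Hy; unfold AbsRing_ball, abs, minus, plus, opp in Hy;
      simpl in Hy.
    apply Rabs_def2 in Hy. lra. }
  destruct (filter_ex _ (filter_and _ _ Fr (filter_and _ _ Fu Fv)))
    as [r [[Hr0 Hr] [Bu Bv]]].
  pose proof (Rmin_l a 1). pose proof (Rmin_r a 1).
  exists r. split; [lra |].
  unfold ball in Bu, Bv; simpl in Bu, Bv;
    unfold AbsRing_ball, abs, minus, plus, opp in Bu, Bv; simpl in Bu, Bv.
  apply Rabs_def2 in Bu. apply Rabs_def2 in Bv.
  pose proof (ps_pos _ _ _ Hu r Hr0). pose proof (ps_pos _ _ _ Hv r Hr0).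
  assert (Su : Rabs (r * du r) <= K)
    by (apply Rle_trans with M; [apply HM; lra | apply Rmax_l]).
  assert (Sv : Rabs (r * dv r) <= K)
    by (apply Rle_trans with N; [apply HN; lra | apply Rmax_r]).
  unfold h, wronskian.
  replace (r * (u r * dv r - v r * du r))
    with (u r * (r * dv r) + - (v r * (r * du r))) by ring.
  apply Rle_lt_trans with (1 := Rabs_triang _ _).
  rewrite Rabs_Ropp, !Rabs_mult, (Rabs_right (u r)), (Rabs_right (v r)) by lra.
  rewrite <- !Rabs_mult.
  assert (E : d / (2 * K + 1) * (2 * K + 1) = d) by (field; lra).
  set (t := d / (2 * K + 1)) in *.
  assert (u r * Rabs (r * dv r) <= t * K)
    by (apply Rmult_le_compat; try lra; apply Rabs_pos).
  assert (v r * Rabs (r * du r) <= t * K)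
    by (apply Rmult_le_compat; try lra; apply Rabs_pos).
  lra.
Qed.

Hypothesis Hsub : forall r, 0 < r -> 0 <= Lu r.
Hypothesis Hsup : forall r, 0 < r -> Lv r <= 0.

Lemma wronskian_decreasing (r : R) : 0 < r -> 1 < u r / v r -> dh r < 0.
Proof.
  intros Hr Hq.
  pose proof (ps_pos _ _ _ Hu r Hr). pose proof (ps_pos _ _ _ Hv r Hr).
  pose proof (Hsub r Hr). pose proof (Hsup r Hr).
  assert (Huv : v r < u r).
  { apply Rmult_lt_reg_r with (/ v r); [now apply Rinv_0_lt_compat |].
    rewrite Rinv_r by lra. exact Hq. }
  unfold dh.
  assert (u r * Lv r <= 0) by nra.
  assert (0 <= v r * Lu r) by nra.
  assert (0 < u r * v r) by nra.
  assert (v r ^ 2 - u r ^ 2 < 0) by nra.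
  assert (u r * v r * (v r ^ 2 - u r ^ 2) < 0) by nra.
  nra.
Qed.

(** From a point where [u > v], follow the side on which [u / v] starts growing; it
    keeps growing there.  On the right it is unbounded, on the left it contradicts
    [wronskian_small]. *)
Theorem sub_le_super (r : R) : 0 < r -> u r <= v r.
Proof.
  intros Hr.
  destruct (Rle_lt_dec (u r) (v r)) as [H | Huv]; [exact H | exfalso].
  assert (Hq : 1 < u r / v r).
  { pose proof (ps_pos _ _ _ Hv r Hr). apply Rmult_lt_reg_r with (v r); [lra |].
    replace (u r / v r * v r) with (u r) by (field; lra). lra. }
  assert (Hp : forall x, 0 < x -> 0 < / (x * v x ^ 2)).
  { intros x Hx. pose proof (ps_pos _ _ _ Hv x Hx).
    apply Rinv_0_lt_compat, Rmult_lt_0_compat; [exact Hx | now apply pow_lt]. }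
  assert (Hdec : forall a b, 0 < a -> a < b ->
    (forall x, a <= x <= b -> 1 < u x / v x) -> h b < h a).
  { intros a b Ha Hab Hx.
    destruct (mean_value h dh a b Hab) as [y [Hy E]].
    - intros x Hx'. apply is_derive_wronskian. lra.
    - pose proof (wronskian_decreasing y ltac:(lra) (Hx y ltac:(lra))). nra. }
  destruct (Rle_lt_dec (h r) 0) as [Hh | Hh].
  - assert (Hright : forall s, r <= s -> 1 < u s / v s).
    { intros s Hs.
      apply (excursion_right (fun x => u x / v x) (fun x => / (x * v x ^ 2)) h dh r s);
        try lra.
      - intros x Hx. apply is_derive_ratio. lra.
      - intros x Hx. apply Hp. lra.
      - intros x Hx. apply is_derive_wronskian. lra.
      - intros x Hx. apply wronskian_decreasing. lra. }
    set (a := r + 1). set (d := - h a).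
    assert (Hd : 0 < d).
    { unfold d. pose proof (Hdec r a Hr ltac:(unfold a; lra)
        ltac:(intros; apply Hright; lra)). lra. }
    destruct (ps_floor _ _ _ Hv) as [m [Hm Hfl]].
    (* u / v - d ln increases beyond a, since v <= 1; b is far enough for d ln to
       gain 1 / m, which is an upper bound of u / v. *)
    set (b := a * exp (/ (m * d))).
    assert (Hmd : 0 < / (m * d)) by (apply Rinv_0_lt_compat; nra).
    assert (Hab : a < b).
    { unfold b. pose proof (exp_ineq1 (/ (m * d)) ltac:(lra)).
      assert (0 < a) by (unfold a; lra). nra. }
    destruct (mean_value (fun x => u x / v x - d * ln x)
      (fun x => - (/ (x * v x ^ 2) * h x) - d * / x) a b Hab) as [y [Hy E]].
    { intros x Hx. assert (0 < x) by (unfold a in Hx; lra).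
      apply (is_derive_minus (fun x => u x / v x) (fun x => d * ln x)).
      - now apply is_derive_ratio.
      - auto_derive; [assumption | ring]. }
    cbv beta in E.
    assert (Hy0 : r + 1 < y) by (unfold a in Hy; lra).
    assert (Hhy : h y < h a).
    { apply Hdec; [unfold a; lra | lra |]. intros x Hx. apply Hright.
      unfold a in Hx; lra. }
    pose proof (ps_pos _ _ _ Hv y ltac:(lra)). pose proof (ps_le_1 _ _ _ Hv y ltac:(lra)).
    assert (Hslope : 0 <= - (/ (y * v y ^ 2) * h y) - d * / y).
    { replace (- (/ (y * v y ^ 2) * h y) - d * / y)
        with ((- h y - d * v y ^ 2) * / (y * v y ^ 2)) by (field; lra).
      apply Rmult_le_pos; [| left; apply Hp; lra].
      assert (v y ^ 2 <= 1) by nra. unfold d in *. nra. }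
    assert (Hln : ln b = ln a + / (m * d)).
    { unfold b. rewrite ln_mult, ln_exp; [ring | unfold a; lra | apply exp_pos]. }
    assert (Hle : u a / v a - d * ln a <= u b / v b - d * ln b) by nra.
    rewrite Hln in Hle.
    replace (d * (ln a + / (m * d))) with (d * ln a + / m) in Hle by (field; lra).
    pose proof (Hright a ltac:(unfold a; lra)) as Hqa.
    assert (Hb1 : 1 <= b) by (unfold a in Hab; lra).
    assert (Hqb : u b / v b <= / m).
    { pose proof (Hfl b Hb1). pose proof (ps_le_1 _ _ _ Hu b ltac:(lra)).
      pose proof (ps_pos _ _ _ Hu b ltac:(lra)).
      assert (/ v b <= / m) by (apply Rinv_le_contravar; lra).
      assert (0 < / v b) by (apply Rinv_0_lt_compat; lra).
      unfold Rdiv. nra. }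
    lra.
  - assert (Hleft : forall s, 0 < s <= r -> 1 < u s / v s).
    { intros s Hs.
      apply (excursion_left (fun x => u x / v x) (fun x => / (x * v x ^ 2)) h dh s r);
        try lra.
      - intros x Hx. apply is_derive_ratio. lra.
      - intros x Hx. apply Hp. lra.
      - intros x Hx. apply is_derive_wronskian. lra.
      - intros x Hx. apply wronskian_decreasing. lra. }
    destruct (wronskian_small (h r) r Hh Hr) as [s [Hs Hhs]].
    apply Rabs_def2 in Hhs.
    pose proof (Hdec s r ltac:(lra) ltac:(lra) ltac:(intros; apply Hleft; lra)).
    lra.
Qed.

End Comparison.

(** At a contact point [z = v - u] has a zero minimum, and
    r (r z')' = r^2 (L v - L u) + (n^2 + r^2 (u^2 + u v + v^2 - 1)) z,
    where the first term is nonpositive and the factor of [z] is bounded on bounded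
    intervals.  So [z] vanishes to the right of the contact point.  The residuals are
    only required to differ at arbitrarily large radii, because the residual of the
    extremal lower bound for n = 2 has an interior zero. *)
Theorem sub_lt_super (n : nat) (u du d2u v dv d2v : R -> R) :
  profile_shape u du d2u -> profile_shape v dv d2v ->
  (forall r, 0 < r -> 0 <= vortex_residual n u du d2u r) ->
  (forall r, 0 < r -> vortex_residual n v dv d2v r <= 0) ->
  (forall a, 0 < a -> exists r, a < r /\
     vortex_residual n v dv d2v r < vortex_residual n u du d2u r) ->
  forall r, 0 < r -> u r < v r.
Proof.
  intros Hu Hv Hsub Hsup Hne a Ha.
  set (z := fun r => v r - u r).
  set (dz := fun r => dv r - du r).
  set (d2z := fun r => d2v r - d2u r).
  assert (Hz : forall r, 0 < r -> 0 <= z r).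
  { intros r Hr. unfold z.
    pose proof (sub_le_super n u du d2u v dv d2v Hu Hv Hsub Hsup r Hr). lra. }
  assert (Dz : forall r, 0 < r -> is_derive z r (dz r)).
  { intros r Hr.
    apply (is_derive_minus v u);
      [apply (ps_derive _ _ _ Hv r Hr) | apply (ps_derive _ _ _ Hu r Hr)]. }
  assert (D2z : forall r, 0 < r -> is_derive dz r (d2z r)).
  { intros r Hr.
    apply (is_derive_minus dv du);
      [apply (ps_derive2 _ _ _ Hv r Hr) | apply (ps_derive2 _ _ _ Hu r Hr)]. }
  assert (Hdz : forall r, 0 < r -> z r = 0 -> dz r = 0).
  { intros r Hr Hzr. exact (derive_at_zero_minimum z r (dz r) Hr Hz Hzr (Dz r Hr)). }
  destruct (Rlt_le_dec (u a) (v a)) as [H | Hle]; [exact H | exfalso].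
  assert (Hza : z a = 0) by (pose proof (Hz a Ha); unfold z in *; lra).
  destruct (Hne a Ha) as [b [Hab Hb]].
  assert (Hflat : forall s, a <= s <= b + 1 -> z s = 0).
  { intros s Hs. apply Rle_antisym; [| apply Hz; lra].
    pose proof (pos_INR n) as Hn.
    (* The square of this l dominates n^2 + 2 (b + 1)^2. *)
    apply (zero_cauchy_data_nonpos z dz d2z (INR n + 2 * (b + 1)) a s); try lra.
    - intros r Hr. apply Dz. lra.
    - intros r Hr. apply D2z. lra.
    - intros r Hr. assert (Hr0 : 0 < r) by lra.
      pose proof (Hsub r Hr0) as Su. pose proof (Hsup r Hr0) as Sv.
      pose proof (ps_pos _ _ _ Hu r Hr0). pose proof (ps_pos _ _ _ Hv r Hr0).
      pose proof (ps_le_1 _ _ _ Hu r Hr0). pose proof (ps_le_1 _ _ _ Hv r Hr0).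
      assert (E : r * (r * d2z r + dz r)
        = r ^ 2 * (vortex_residual n v dv d2v r - vortex_residual n u du d2u r)
          + (INR n ^ 2 + r ^ 2 * (u r ^ 2 + u r * v r + v r ^ 2 - 1)) * z r).
      { unfold z, dz, d2z, vortex_residual. field. lra. }
      rewrite E. pose proof (Hz r Hr0) as Hzr.
      assert (r ^ 2 * (vortex_residual n v dv d2v r - vortex_residual n u du d2u r) <= 0)
        by nra.
      assert (u r ^ 2 + u r * v r + v r ^ 2 - 1 <= 2) by nra.
      assert (0 <= r ^ 2 <= (b + 1) ^ 2) by nra.
      assert (r ^ 2 * (u r ^ 2 + u r * v r + v r ^ 2 - 1) <= 2 * (b + 1) ^ 2) by nra.
      assert (INR n ^ 2 + r ^ 2 * (u r ^ 2 + u r * v r + v r ^ 2 - 1)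
              <= (INR n + 2 * (b + 1)) ^ 2) by nra.
      nra.
    - now apply Hdz. }
  assert (Hd2z : d2z b < 0).
  { pose proof (Hflat b ltac:(lra)) as Hzb. pose proof (Hdz b ltac:(lra) Hzb) as Hdzb.
    unfold z, dz in *. unfold vortex_residual in Hb. unfold d2z.
    replace (v b) with (u b) in Hb by lra. replace (dv b) with (du b) in Hb by lra. lra. }
  destruct (is_derive_neg_right dz b (d2z b) (D2z b ltac:(lra)) Hd2z) as [e [He Hr]].
  destruct (small_step e 1) as [t [Ht Ht1]]; try lra.
  pose proof (Hr t Ht) as Hlt.
  rewrite (Hdz b) in Hlt by (try apply Hflat; lra).
  rewrite (Hdz (b + t)) in Hlt by (try apply Hflat; lra). lra.
Qed.

(** * Vortex profiles *)

Lemma vortex_profile_residual (n : nat) (f : R -> R) :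
  vortex_profile n f ->
  forall r, 0 < r -> vortex_residual n f (Derive f) (Derive (Derive f)) r = 0.
Proof. intros Hf r Hr. exact (vp_ode _ _ Hf r Hr). Qed.

(** For [ps_slope]: by the equation,
    r (r f')' = (n^2 - r^2 (1 - f^2)) f >= 0 for r <= 1, so the nonnegative function
    [r f'] is at most its value at 1. *)
Lemma vortex_profile_shape (n : nat) (f : R -> R) :
  (1 <= n)%nat -> vortex_profile n f ->
  profile_shape f (Derive f) (Derive (Derive f)).
Proof.
  intros Hn Hf.
  assert (D : forall r, 0 < r -> is_derive f r (Derive f r))
    by (intros r Hr; apply Derive_correct, (vp_ex_derive _ _ Hf r Hr)).
  assert (D2 : forall r, 0 < r -> is_derive (Derive f) r (Derive (Derive f) r))
    by (intros r Hr; apply Derive_correct, (vp_ex_derive2 _ _ Hf r Hr)).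
  assert (Hpos : forall r, 0 < r -> 0 < f r).
  { intros r Hr. pose proof (vp_nonneg _ _ Hf (r / 2) ltac:(lra)).
    pose proof (vp_increasing _ _ Hf (r / 2) r ltac:(lra) ltac:(lra)). lra. }
  assert (Hle1 : forall r, 0 < r -> f r <= 1).
  { intros r Hr.
    apply (is_lim_le_loc (fun _ => f r) f p_infty (f r) 1).
    - exists r. intros s Hs. left. now apply (vp_increasing _ _ Hf).
    - apply is_lim_const.
    - apply (vp_at_infty _ _ Hf). }
  assert (Hd : forall r, 0 < r -> 0 <= Derive f r).
  { intros r Hr. destruct (Rle_lt_dec 0 (Derive f r)) as [H | H]; [exact H | exfalso].
    destruct (is_derive_neg_right f r _ (D r Hr) H) as [e [He Hlt]].
    pose proof (Hlt (e / 2) ltac:(lra)).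
    pose proof (vp_increasing _ _ Hf r (r + e / 2) Hr ltac:(lra)). lra. }
  split; auto.
  - apply (vp_at_zero _ _ Hf).
  - exists (Derive f 1). intros r [Hr Hr1].
    pose proof (Hd r Hr). rewrite Rabs_right by nra.
    destruct Hr1 as [Hr1 | ->]; [| lra].
    destruct (mean_value (fun s => s * Derive f s)
      (fun s => Derive f s + s * Derive (Derive f) s) r 1 Hr1) as [y [Hy E]].
    { intros s Hs. rewrite <- (Rmult_1_l (Derive f s)).
      apply (is_derive_mult (fun t => t) (Derive f)).
      - auto_derive; [exact I | reflexivity].
      - apply D2. lra.
      - intros; apply Rmult_comm. }
    cbv beta in E.
    pose proof (vp_ode _ _ Hf y ltac:(lra)) as Hode.
    pose proof (Hpos y ltac:(lra)). pose proof (Hle1 y ltac:(lra)).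
    assert (HN : 1 <= INR n) by (apply (le_INR 1 n Hn)).
    assert (Ey : y * (Derive f y + y * Derive (Derive f) y)
      = (INR n ^ 2 - y ^ 2 * (1 - f y ^ 2)) * f y
        + y ^ 2 * (Derive (Derive f) y + 1 / y * Derive f y - INR n ^ 2 / y ^ 2 * f y
      + (1 - f y ^ 2) * f y)) by (field; lra).
    rewrite Hode in Ey.
    assert (y ^ 2 * (1 - f y ^ 2) <= 1) by nra.
    assert (1 <= INR n ^ 2) by nra.
    assert (0 <= Derive f y + y * Derive (Derive f) y) by nra.
    nra.
  - exists (f 1). split; [apply Hpos; lra |].
    intros r [Hr | <-]; [left; apply (vp_increasing _ _ Hf); lra | lra].
Qed.

(** * The comparison functions *)

(** [ad_ge] makes r^n / sqrt P at most 1, [ad_slope] bounds its logarithmic slope,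
    and [ad_le] keeps it away from 0 at infinity. *)
Record ansatz_denominator (n : nat) (P dP d2P : R -> R) : Prop := {
  ad_derive : forall r, is_derive P r (dP r);
  ad_derive2 : forall r, is_derive dP r (d2P r);
  ad_pos : forall r, 0 <= r -> 0 < P r;
  ad_ge : forall r, 0 < r -> r ^ (2 * n) <= P r;
  ad_slope : forall r, 0 < r -> 0 <= r * dP r <= 2 * INR n * P r;
  ad_le : exists K, forall r, 1 <= r -> P r <= K * r ^ (2 * n)
}.

Section Ansatz.

Variables (n : nat) (P dP d2P : R -> R).
Hypothesis n_pos : (1 <= n)%nat.
Hypothesis HP : ansatz_denominator n P dP d2P.

Let HdP := ad_derive _ _ _ _ HP.
Let Hd2P := ad_derive2 _ _ _ _ HP.
Let P_pos := ad_pos _ _ _ _ HP.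

Definition ansatz (r : R) : R := r ^ n / sqrt (P r).

(** Both derivatives are written as multiples of the function itself, through its
    logarithmic derivative n/r - P'/(2 P), so that the square root cancels from the
    residual. *)
Definition dansatz (r : R) : R := ansatz r * (INR n / r - dP r / (2 * P r)).
Definition d2ansatz (r : R) : R :=
  ansatz r * ((INR n / r - dP r / (2 * P r)) ^ 2
    + (- INR n / r ^ 2 - d2P r / (2 * P r) + dP r ^ 2 / (2 * P r ^ 2))).

Lemma is_derive_ansatz (r : R) : 0 < r -> is_derive ansatz r (dansatz r).
Proof.
  intros Hr. pose proof (P_pos r ltac:(lra)) as Pr.
  pose proof (sqrt_lt_R0 _ Pr) as Hs.
  pose proof (sqrt_sqrt (P r) ltac:(lra)) as Hss.
  unfold ansatz, dansatz, ansatz. auto_derive.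
  - repeat split; try lra. eexists; apply HdP.
  - replace (Derive (fun x => P x) r) with (dP r)
      by (symmetry; apply is_derive_unique, HdP).
    assert (Hn : INR n * r ^ n = INR n * (r * r ^ pred n)).
    { destruct n as [| k]; [simpl; ring |]. reflexivity. }
    transitivity (INR n * (r * r ^ pred n) / r / sqrt (P r)
                  - dP r * r ^ n / (2 * (sqrt (P r) * sqrt (P r)) * sqrt (P r))).
    + field. lra.
    + rewrite <- Hn, Hss. field. lra.
Qed.

Lemma is_derive_dansatz (r : R) : 0 < r -> is_derive dansatz r (d2ansatz r).
Proof.
  intros Hr. pose proof (P_pos r ltac:(lra)) as Pr.
  pose proof (is_derive_ansatz r Hr) as D.
  unfold dansatz at 1. auto_derive.
  - repeat split; try lra; eexists; [exact D | apply Hd2P | apply HdP].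
  - replace (Derive (fun x => P x) r) with (dP r)
      by (symmetry; apply is_derive_unique, HdP).
    replace (Derive (fun x => dP x) r) with (d2P r)
      by (symmetry; apply is_derive_unique, Hd2P).
    replace (Derive (fun x => ansatz x) r) with (dansatz r)
      by (symmetry; apply is_derive_unique, D).
    unfold d2ansatz, dansatz. field. lra.
Qed.

(** The residual of the ansatz multiplied by P^2 / w: for an even polynomial P this
    is a polynomial in r^2. *)
Definition ansatz_excess (r : R) : R :=
  3 / 4 * dP r ^ 2 - P r * d2P r / 2 - (INR n + 1 / 2) * P r * dP r / r
  + P r * (P r - r ^ (2 * n)).

Lemma ansatz_residual (r : R) :
  0 < r ->
  vortex_residual n ansatz dansatz d2ansatz r = ansatz r / P r ^ 2 * ansatz_excess r.
Proof.
  intros Hr. pose proof (P_pos r ltac:(lra)) as Pr.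
  assert (Hsq : ansatz r ^ 2 = r ^ (2 * n) / P r).
  { unfold ansatz. rewrite Nat.mul_comm, pow_mult.
    replace ((r ^ n / sqrt (P r)) ^ 2) with ((r ^ n) ^ 2 / (sqrt (P r) * sqrt (P r)))
      by (field; apply Rgt_not_eq, sqrt_lt_R0, Pr).
    now rewrite sqrt_sqrt by lra. }
  unfold vortex_residual. rewrite Hsq.
  unfold d2ansatz, dansatz, ansatz_excess. field. lra.
Qed.

Lemma ansatz_pos (r : R) : 0 < r -> 0 < ansatz r.
Proof.
  intros Hr. apply Rdiv_lt_0_compat; [now apply pow_lt |].
  apply sqrt_lt_R0, P_pos. lra.
Qed.

Lemma ansatz_shape : profile_shape ansatz dansatz d2ansatz.
Proof.
  assert (Hpow : forall r, 0 < r -> sqrt (r ^ (2 * n)) = r ^ n).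
  { intros r Hr. replace (r ^ (2 * n)) with (Rsqr (r ^ n)).
    - apply sqrt_Rsqr. left. now apply pow_lt.
    - unfold Rsqr. rewrite Nat.mul_comm, pow_mult. ring. }
  assert (Hle1 : forall r, 0 < r -> ansatz r <= 1).
  { intros r Hr. pose proof (sqrt_lt_R0 _ (P_pos r ltac:(lra))).
    apply Rmult_le_reg_r with (sqrt (P r)); [lra |].
    replace (ansatz r * sqrt (P r)) with (r ^ n) by (unfold ansatz; field; lra).
    rewrite <- Hpow, Rmult_1_l by assumption.
    apply sqrt_le_1_alt, (ad_ge _ _ _ _ HP r Hr). }
  split.
  - exact is_derive_ansatz.
  - exact is_derive_dansatz.
  - exact ansatz_pos.
  - exact Hle1.
  - assert (H0 : ansatz 0 = 0).
    { unfold ansatz. rewrite pow_ne_zero by lia. unfold Rdiv. ring. }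
    rewrite <- H0 at 2.
    apply (filterlim_filter_le_1 _ (filter_le_within _)).
    apply (ex_derive_continuous ansatz 0). unfold ansatz. auto_derive.
    pose proof (P_pos 0 ltac:(lra)). repeat split; [eexists; apply HdP | lra |].
    apply Rgt_not_eq, sqrt_lt_R0. lra.
  - exists (INR n). intros r Hr.
    pose proof (ansatz_pos r ltac:(lra)). pose proof (Hle1 r ltac:(lra)).
    pose proof (P_pos r ltac:(lra)). pose proof (ad_slope _ _ _ _ HP r ltac:(lra)).
    pose proof (pos_INR n).
    replace (r * dansatz r) with (ansatz r * (INR n - r * dP r / (2 * P r)))
      by (unfold dansatz; field; lra).
    assert (0 <= r * dP r / (2 * P r)) by (apply Rdiv_le_0_compat; lra).
    assert (r * dP r / (2 * P r) <= INR n) by (apply Rle_div_l; lra).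
    rewrite Rabs_right by nra. nra.
  - destruct (ad_le _ _ _ _ HP) as [K HK].
    assert (HK0 : 0 < K).
    { pose proof (HK 1 ltac:(lra)) as H1. rewrite pow1 in H1.
      pose proof (P_pos 1 ltac:(lra)). lra. }
    pose proof (sqrt_lt_R0 _ HK0) as Hs.
    exists (/ sqrt K). split; [now apply Rinv_0_lt_compat |].
    intros r Hr. pose proof (sqrt_lt_R0 _ (P_pos r ltac:(lra))).
    assert (Hrn : 0 < r ^ n) by (apply pow_lt; lra).
    assert (Hsq : sqrt (P r) <= sqrt K * r ^ n).
    { rewrite <- Hpow, <- sqrt_mult_alt by lra. apply sqrt_le_1_alt. auto. }
    apply Rmult_le_reg_r with (sqrt K * sqrt (P r)); [nra |].
    unfold ansatz. field_simplify; lra.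
Qed.

Theorem profile_lt_ansatz (f : R -> R) :
  vortex_profile n f -> (forall r, 0 < r -> ansatz_excess r < 0) ->
  forall r, 0 < r -> f r < ansatz r.
Proof.
  intros Hf Hneg.
  pose proof (vortex_profile_residual n f Hf) as Rf.
  assert (Rw : forall r, 0 < r -> vortex_residual n ansatz dansatz d2ansatz r < 0).
  { intros r Hr. rewrite ansatz_residual by assumption.
    pose proof (Hneg r Hr). pose proof (ansatz_pos r Hr).
    assert (0 < ansatz r / P r ^ 2)
      by (apply Rdiv_lt_0_compat; [| apply pow_lt, P_pos]; lra).
    nra. }
  apply (sub_lt_super n f (Derive f) (Derive (Derive f)) ansatz dansatz d2ansatz).
  - now apply vortex_profile_shape with n.
  - exact ansatz_shape.
  - intros r Hr. rewrite Rf; lra.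
  - intros r Hr. left. auto.
  - intros a Ha. exists (a + 1). split; [lra |]. rewrite Rf by lra. apply Rw. lra.
Qed.

Theorem ansatz_lt_profile (f : R -> R) :
  vortex_profile n f -> (forall r, 0 < r -> 0 <= ansatz_excess r) ->
  (forall a, 0 < a -> exists r, a < r /\ 0 < ansatz_excess r) ->
  forall r, 0 < r -> ansatz r < f r.
Proof.
  intros Hf Hnn Hne.
  pose proof (vortex_profile_residual n f Hf) as Rf.
  assert (Hc : forall r, 0 < r -> 0 < ansatz r / P r ^ 2).
  { intros r Hr. pose proof (ansatz_pos r Hr).
    apply Rdiv_lt_0_compat; [| apply pow_lt, P_pos]; lra. }
  apply (sub_lt_super n ansatz dansatz d2ansatz f (Derive f) (Derive (Derive f))).
  - exact ansatz_shape.
  - now apply vortex_profile_shape with n.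
  - intros r Hr. rewrite ansatz_residual by assumption.
    pose proof (Hc r Hr). pose proof (Hnn r Hr). nra.
  - intros r Hr. rewrite Rf; lra.
  - intros a Ha. destruct (Hne a Ha) as [r [Har Hr]]. exists r. split; [exact Har |].
    rewrite Rf, ansatz_residual by lra.
    pose proof (Hc r ltac:(lra)). nra.
Qed.

End Ansatz.

(** * The two families of denominators *)

Lemma even_powers_nonneg (r : R) : 0 <= r ^ 2 /\ 0 <= r ^ 4 /\ 0 <= r ^ 6.
Proof.
  pose proof (pow2_ge_0 r). pose proof (pow2_ge_0 (r ^ 2)). pose proof (pow2_ge_0 (r ^ 3)).
  replace (r ^ 4) with ((r ^ 2) ^ 2) by ring.
  replace (r ^ 6) with ((r ^ 3) ^ 2) by ring. lra.
Qed.

Definition quartic (c r : R) : R := r ^ 4 + 4 * r ^ 2 + c.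
Definition dquartic (r : R) : R := 4 * r ^ 3 + 8 * r.
Definition d2quartic (r : R) : R := 12 * r ^ 2 + 8.

Lemma quartic_denominator (c : R) :
  0 < c -> ansatz_denominator 2 (quartic c) dquartic d2quartic.
Proof.
  intros Hc. split; unfold quartic, dquartic, d2quartic; simpl INR; simpl (2 * 2)%nat.
  - intros r. auto_derive; [exact I | ring].
  - intros r. auto_derive; [exact I | ring].
  - intros r _. pose proof (even_powers_nonneg r). lra.
  - intros r _. pose proof (even_powers_nonneg r). lra.
  - intros r _. pose proof (even_powers_nonneg r).
    replace (r * (4 * r ^ 3 + 8 * r)) with (4 * r ^ 4 + 8 * r ^ 2) by ring. lra.
  - exists (5 + c). intros r Hr.
    assert (r ^ 2 <= r ^ 4) by (apply Rle_pow; [exact Hr | lia]).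
    assert (1 <= r ^ 4) by now apply pow_R1_Rle.
    nra.
Qed.

Lemma quartic_excess (c r : R) :
  0 < r ->
  ansatz_excess 2 (quartic c) dquartic d2quartic r
  = (c - 24) * (r ^ 4 + c) - 8 * (c + 6) * r ^ 2.
Proof.
  intros Hr. unfold ansatz_excess, quartic, dquartic, d2quartic.
  simpl INR. simpl (2 * 2)%nat. field. lra.
Qed.

(** As a quadratic in r^2, the excess has a double root s exactly when s^2 = c and
    4 (c + 6) = s (c - 24); that is, (s + 2) (s^2 - 6 s - 12) = 0, whose positive
    root is 3 + sqrt 21. *)
Lemma quartic_excess_square (c s r : R) :
  0 < r -> s = 3 + sqrt 21 -> c = s ^ 2 ->
  ansatz_excess 2 (quartic c) dquartic d2quartic r = (c - 24) * (r ^ 2 - s) ^ 2.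
Proof.
  intros Hr Hs ->.
  assert (Hs2 : s ^ 2 = 6 * s + 12).
  { pose proof (sqrt_sqrt 21 ltac:(lra)). rewrite Hs. nra. }
  rewrite quartic_excess by exact Hr. rewrite Hs2.
  replace ((6 * s + 12 - 24) * (r ^ 2 - s) ^ 2)
    with ((6 * s + 12 - 24) * (r ^ 4 + s ^ 2) - r ^ 2 * (12 * s ^ 2 - 24 * s)) by ring.
  rewrite Hs2. ring.
Qed.

Definition sextic (C r : R) : R := r ^ 6 + 9 * r ^ 4 + 99 * r ^ 2 + C.
Definition dsextic (r : R) : R := 6 * r ^ 5 + 36 * r ^ 3 + 198 * r.
Definition d2sextic (r : R) : R := 30 * r ^ 4 + 108 * r ^ 2 + 198.

Lemma sextic_denominator (C : R) :
  0 < C -> ansatz_denominator 3 (sextic C) dsextic d2sextic.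
Proof.
  intros HC. split; unfold sextic, dsextic, d2sextic; simpl INR; simpl (2 * 3)%nat.
  - intros r. auto_derive; [exact I | ring].
  - intros r. auto_derive; [exact I | ring].
  - intros r _. pose proof (even_powers_nonneg r). lra.
  - intros r _. pose proof (even_powers_nonneg r). lra.
  - intros r _. pose proof (even_powers_nonneg r).
    replace (r * (6 * r ^ 5 + 36 * r ^ 3 + 198 * r))
      with (6 * r ^ 6 + 36 * r ^ 4 + 198 * r ^ 2) by ring.
    lra.
  - exists (109 + C). intros r Hr.
    assert (r ^ 4 <= r ^ 6) by (apply Rle_pow; [exact Hr | lia]).
    assert (r ^ 2 <= r ^ 6) by (apply Rle_pow; [exact Hr | lia]).
    assert (1 <= r ^ 6) by now apply pow_R1_Rle.
    nra.
Qed.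

Lemma sextic_excess (C r : R) :
  0 < r ->
  ansatz_excess 3 (sextic C) dsextic d2sextic r
  = (C - 1440) * r ^ 6 - (18 * C + 4455) * r ^ 4 + (18 * C - 49005) * r ^ 2
    + C * (C - 792).
Proof.
  intros Hr. unfold ansatz_excess, sextic, dsextic, d2sextic.
  simpl INR. simpl (2 * 3)%nat. field. lra.
Qed.

Theorem proposition2p3 :
  (forall f2 : R -> R, vortex_profile 2 f2 ->
     forall r : R, 0 < r ->
       r ^ 2 / sqrt (r ^ 4 + 4 * r ^ 2 + 30 + 6 * sqrt 21) < f2 r
         < r ^ 2 / sqrt (r ^ 4 + 4 * r ^ 2 + 24)) /\
  (forall f3 : R -> R, vortex_profile 3 f3 ->
     forall r C : R, 0 < r -> 0 < C < 792 ->
       g 4000 r < f3 r < g C r).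
Proof.
  pose proof (sqrt_sqrt 21 ltac:(lra)) as H21.
  pose proof (sqrt_lt_R0 21 ltac:(lra)) as H21pos.
  split.
  - intros f2 Hf r Hr. split.
    + set (c := 30 + 6 * sqrt 21).
      replace (r ^ 4 + 4 * r ^ 2 + 30 + 6 * sqrt 21) with (quartic c r)
        by (unfold quartic, c; ring).
      assert (Hc : c = (3 + sqrt 21) ^ 2) by (unfold c; nra).
      assert (Hc24 : 24 < c) by (unfold c; lra).
      apply (ansatz_lt_profile 2 (quartic c) dquartic d2quartic); auto.
      * apply quartic_denominator; lra.
      * intros s Hs.
        rewrite (quartic_excess_square c (3 + sqrt 21)) by auto.
        apply Rmult_le_pos; [lra | apply pow2_ge_0].
      * intros a Ha. exists (a + 3 + sqrt 21). split; [lra |].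
        rewrite (quartic_excess_square c (3 + sqrt 21)) by (auto; lra).
        apply Rmult_lt_0_compat; [lra |]. apply pow_lt. nra.
    + change (f2 r < ansatz 2 (quartic 24) r).
      apply (profile_lt_ansatz 2 (quartic 24) dquartic d2quartic); auto.
      * apply quartic_denominator; lra.
      * intros s Hs. rewrite quartic_excess by exact Hs. nra.
  - intros f3 Hf r C Hr HC. split.
    + change (ansatz 3 (sextic 4000) r < f3 r).
      assert (Hex : forall s, 0 < s ->
                0 < ansatz_excess 3 (sextic 4000) dsextic d2sextic s).
      { intros s Hs. rewrite sextic_excess by exact Hs.
        replace (s ^ 6) with ((s ^ 2) ^ 3) by ring.
        replace (s ^ 4) with ((s ^ 2) ^ 2) by ring.
        assert (0 <= s ^ 2) by nra.
        set (x := s ^ 2) in *.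
        (* The cubic in x has its positive minimum near x = 20. *)
        assert (0 <= x * (x - 20) ^ 2) by (apply Rmult_le_pos; [lra | apply pow2_ge_0]).
        pose proof (pow2_ge_0 (x - 20)). nra. }
      apply (ansatz_lt_profile 3 (sextic 4000) dsextic d2sextic); auto.
      * apply sextic_denominator; lra.
      * intros s Hs. left. auto.
      * intros a Ha. exists (a + 1). split; [lra |]. apply Hex. lra.
    + change (f3 r < ansatz 3 (sextic C) r).
      apply (profile_lt_ansatz 3 (sextic C) dsextic d2sextic); auto.
      * apply sextic_denominator; lra.
      * intros s Hs. rewrite sextic_excess by exact Hs.
        pose proof (even_powers_nonneg s).
        assert (C * (C - 792) < 0) by nra.
        assert ((C - 1440) * s ^ 6 <= 0) by nra.
        assert (0 <= (18 * C + 4455) * s ^ 4) by nra.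
        assert ((18 * C - 49005) * s ^ 2 <= 0) by nra.
        lra.
Qed.
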